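(* Let $1\le i<j$ be fixed integers and fix $0<c<1$. Let $m=cn$ and let $\pi$ be chosen uniformly at random from $\mathrm{PF}(m,n)$. Then, as $n\to\infty$, $$\operatorname{Var}(k_i)\sim\frac{ic}{(1-c)^3},\qquad \operatorname{Cov}(k_i,k_j)\sim\frac{ic}{(1-c)^3},$$ where $k_i=k_i(\pi)$ is the $i$th unattempted spot of $\pi$.
   Context: Write $[n]=\{1,\dots,n\}$. For integers $0\le m\le n$, $\mathrm{PF}(m,n)$ denotes the set of parking functions with $m$ cars and $n$ spots: sequences $(\pi_1,\dots,\pi_m)\in[n]^m$ such that, when cars $1,\dots,m$ enter in order a one-way street with spots $1,\dots,n$ and car $i$ parks in spot $\pi_i$ if it is free and otherwise in the first free spot after $\pi_i$, all cars park. Equivalently, the non-decreasing rearrangement $(\lambda_1,\dots,\lambda_m)$ satisfies $\lambda_i\le n-m+i$ for all $i$. For $\pi\in\mathrm{PF}(m,n)$ exactly $n-m$ spots are never attempted by any car (they are the spots left empty after all cars have parked); they are listed as $k_1(\pi)<k_2(\pi)<\cdots<k_{n-m}(\pi)$. Here $\sim$ means that the ratio of the two sides tends to $1$; the limit $n\to\infty$ is along integers $n$ with $cn$ an integer (and $n$ large enough that $n-m\ge j$). *)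

(* Defs.v *)
(* MathComp / MathComp-Analysis *)
From HB Require Import structures.
From mathcomp Require Import all_boot all_order all_algebra.
From mathcomp Require Import all_classical all_reals all_analysis.

Set Implicit Arguments.
Unset Strict Implicit.
Unset Printing Implicit Defensive.

Import Order.TTheory GRing.Theory Num.Theory.
Import numFieldNormedType.Exports.

Local Open Scope ring_scope.

(* Spot s of {1, ..., n} is the ordinal of value s - 1. *)

(* [enum 'I_n] is increasing, so the head is the smallest admissible spot. *)
Definition first_free (n : nat) (occ : seq 'I_n) (p : 'I_n) : option 'I_n :=
  ohead [seq q : 'I_n <- enum 'I_n | (p <= q)%N && (q \notin occ)].

(* The spots in which the cars with preferences [prefs] park, in order of
   arrival, when the spots in [occ] are already taken; [None] if some car
   fails to park. *)
Fixpoint park (n : nat) (occ prefs : seq 'I_n) : option (seq 'I_n) :=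
  if prefs is p :: prefs' then
    if first_free occ p is Some q then omap (cons q) (park (q :: occ) prefs')
    else None
  else Some [::].

Definition PF (m n : nat) : {set m.-tuple 'I_n} :=
  [set pi : m.-tuple 'I_n | isSome (park [::] pi)].

(* A car with preference p that parks in q attempts exactly p, p + 1, ..., q.
   Only meaningful on parking functions. *)
Definition attempted (m n : nat) (pi : m.-tuple 'I_n) (s : 'I_n) : bool :=
  has (fun car : 'I_n * 'I_n => (car.1 <= s <= car.2)%N)
      (zip pi (odflt [::] (park [::] pi))).

Definition unattempted (m n : nat) (pi : m.-tuple 'I_n) : seq nat :=
  [seq (val s).+1 | s : 'I_n <- enum 'I_n & ~~ attempted pi s].

(* k_i(pi), with i and the spots counted from 1; the default 0 is used only
   when there are fewer than i unattempted spots. *)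
Definition unattempted_spot (m n i : nat) (pi : m.-tuple 'I_n) : nat :=
  nth 0%N (unattempted pi) i.-1.

(* Moments with respect to the uniform distribution on PF(m, n). *)
Definition PF_mean (R : realType) (m n : nat) (X : m.-tuple 'I_n -> R) : R :=
  (\sum_(pi in PF m n) X pi) / #|PF m n|%:R.

Definition PF_cov (R : realType) (m n : nat) (X Y : m.-tuple 'I_n -> R) : R :=
  PF_mean (fun pi => (X pi - PF_mean X) * (Y pi - PF_mean Y)).

Definition PF_var (R : realType) (m n : nat) (X : m.-tuple 'I_n -> R) : R :=
  PF_mean (fun pi => (X pi - PF_mean X) ^+ 2).

Definition var_k (R : realType) (m n i : nat) : R :=
  PF_var (fun pi : m.-tuple 'I_n => (unattempted_spot i pi)%:R).

Definition cov_k (R : realType) (m n i j : nat) : R :=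
  PF_cov (fun pi : m.-tuple 'I_n => (unattempted_spot i pi)%:R)
         (fun pi : m.-tuple 'I_n => (unattempted_spot j pi)%:R).

(* n tends to infinity along the integers n such that c * n is an integer. *)
Definition integral_multiples (R : realType) (c : R) : set_system nat :=
  within [set n : nat | c * n%:R \is a Num.int]%classic \oo%classic.

(* Main.v *)
(* Only the numbers of cars preferring each spot matter: scanning the spots from
   left to right with a queue of waiting cars, a spot stays empty iff no car is
   waiting and none prefers it.  Conditioning on the number of cars preferring
   the first spot gives a recursion for sums over PF(m, n); with M = n + 1 and
   V_k = M^(m-k) m(m-1)...(m-k+1), the binomial theorem solves it: #PF(m, n) is
   V_0 - V_1, and writing k_i = i + e_i, the sum of e_i is i V_1 and, for i <= j,
   the sum of e_i e_j is the sum over k of (ij [k >= 2] + ik) V_k.  With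
   f_k = V_k / V_0, x = m / M and Q the sum of the k f_k this yields
   Cov(k_i, k_j) = i Q / (1 - x) (1 - j / (M (1 - x))) exactly.  The recursion
   f_(k+1) = (x - k / M) f_k bounds all the moments of f and gives
   Q -> c / (1 - c)^2. *)
Require Import Defs.
From HB Require Import structures.
From mathcomp Require Import all_boot all_order all_algebra.
From mathcomp Require Import all_classical all_reals all_analysis.
From mathcomp Require Import ring lra zify.

Import Order.TTheory GRing.Theory Num.Theory.
Import numFieldNormedType.Exports.

(** * Parking as a queue *)

(* [l] lists the numbers of cars preferring the successive spots and [w] is the
   number of cars arriving at the first of them from the left. *)
Fixpoint empties (w : nat) (l : seq nat) : bitseq :=
  if l is c :: l' then (w + c == 0) :: empties (w + c).-1 l' else [::].

Fixpoint overflow (w : nat) (l : seq nat) : nat :=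
  if l is c :: l' then overflow (w + c).-1 l' else w.

(** The parking criterion in suffix form: the spots from any point on are preferred by at most as
    many cars as they can hold. Suffixes suit the recursion on the first spot. *)
Fixpoint feasible (l : seq nat) : bool :=
  if l is c :: l' then (sumn l <= size l) && feasible l' else true.

(* The number of cars parked before the i-th empty spot.  If c cars prefer the
   first spot, the others of them occupy spots that would otherwise be empty: the
   empty spot number i' + 1 of c :: l is then number i' + c of l alone. *)
Fixpoint excess (i : nat) (l : seq nat) : nat :=
  if i is i'.+1 then
    if l is c :: l' then c + excess (i' + c) l' else 0
  else 0.

Lemma excess0 l : excess 0 l = 0.
Proof. by case: l. Qed.

(** The effect on a mask of empty spots of one more car with preference [p]. *)
Fixpoint fill_first (p : nat) (b : bitseq) : bitseq :=
  if b is x :: b' then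
    if p is p'.+1 then x :: fill_first p' b'
    else if x then false :: b' else false :: fill_first 0 b'
  else [::].

Lemma empties_succ w l : empties w.+1 l = fill_first 0 (empties w l).
Proof.
elim: l w => //= c l IH w; rewrite ?addSn /=; case: (w + c) => [|v] //=.
by rewrite IH.
Qed.

Lemma overflow_succ w l : overflow w.+1 l = overflow w l + ~~ has id (empties w l).
Proof.
elim: l w => [|c l IH] w /=; first by rewrite addn1.
by rewrite ?addSn /=; case: (w + c) => [|v] //=; rewrite ?addn0 // IH.
Qed.

Lemma empties_incr w l p : p < size l ->
  empties w (incr_nth l p) = fill_first p (empties w l).
Proof.
elim: l w p => //= c l IH w [|p] /= lp; last by rewrite IH.
by rewrite ?addnS /=; case: (w + c) => [|v] //=; rewrite empties_succ.
Qed.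

Lemma overflow_incr w l p : p < size l ->
  overflow w (incr_nth l p) =
    overflow w l + ~~ has id (drop p (empties w l)).
Proof.
elim: l w p => //= c l IH w [|p] /= lp; last by rewrite IH.
by rewrite ?addnS /=; case: (w + c) => [|v] //=; rewrite ?addn0 // overflow_succ.
Qed.

Lemma sumn_feasible l : feasible l -> sumn l <= size l.
Proof. by case: l => //= c l /andP[]. Qed.

(** The truncation in [(w + c).-1] is harmless: when no car is present at the first spot,
    feasibility of the tail already bounds its sum by its length. *)
Lemma overflow_eq0 w l :
  (overflow w l == 0) = (w + sumn l <= size l) && feasible l.
Proof.
elim: l w => [|c l IH] w /=; first by rewrite addn0 leqn0 andbT.
rewrite IH andbA addnA; case: (boolP (feasible l)) => [/sumn_feasible le_l|_];
  last by rewrite !andbF.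
by rewrite !andbT; move: le_l; lia.
Qed.

Lemma count_empties l w :
  overflow w l = 0 -> count id (empties w l) + w + sumn l = size l.
Proof.
elim: l w => [|c l IH] w /= H; first by rewrite H.
move/IH: H => <-.
by case: w c => [|w] [|c] /=; lia.
Qed.

(** The [w] waiting cars take the first [w] spots that [l] alone would leave empty, so index [i]
    with a queue is index [i + w] without one. Indices count from 0 while [excess] counts empty
    spots from 1. *)
Lemma nth_empties l w k i : i < count id (empties w l) ->
  nth 0 (mask (empties w l) (iota k.+1 (size l))) i
  = k + i.+1 + w + excess (i.+1 + w) l.
Proof.
elim: l w k i => [|c l IH] w k i //=.
case: (posnP (w + c)) => [/eqP|w_gt0] /=.
  rewrite addn_eq0 => /andP[/eqP-> /eqP->]; case: i => [|i] /=.
    by move=> _; rewrite /= excess0 !addn0 addn1.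
  by rewrite add1n ltnS => /IH ->; rewrite /= !addn0; lia.
rewrite add0n => /IH ->; rewrite /=.
have -> : i + w + c = i.+1 + (w + c).-1 by lia.
lia.
Qed.

Lemma fill_first_set_nth b p q : p <= q -> nth false b q ->
  (forall s, p <= s < q -> ~~ nth false b s) ->
  has id (drop p b) /\ fill_first p b = set_nth false b q false.
Proof.
elim: b p q => [|x b IH] p q pq; first by rewrite nth_nil.
case: p q pq => [|p] [|q] //= pq b_q between; first by rewrite b_q.
- have := between 0 isT; rewrite /= => /negPf->.
  have [|s|] := IH 0 q _ b_q; rewrite ?drop0 //; first exact: (between s.+1).
  by move=> -> ->.
- by have [|s|] := IH p q _ b_q; [|exact: (between s.+1)|move=> ? ->].
Qed.

(** * From the parking process to the queue *)

(** As in [empties], the value [true] marks a free spot. *)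
Definition occupancy {n} (occ : seq 'I_n) : bitseq := [seq x \notin occ | x <- enum 'I_n].

Lemma size_occupancy n (occ : seq 'I_n) : size (occupancy occ) = n.
Proof. by rewrite size_map size_enum_ord. Qed.

Lemma first_freeP n (occ : seq 'I_n) (p : 'I_n) :
  if first_free occ p is Some q then
    [/\ p <= q, q \notin occ,
        forall s : 'I_n, p <= s < q -> s \in occ,
        has id (drop p (occupancy occ)) &
        fill_first p (occupancy occ) = occupancy (q :: occ)]
  else ~~ has id (drop p (occupancy occ)).
Proof.
have nthE (x : 'I_n) : nth false (occupancy occ) x = (x \notin occ).
  by rewrite (nth_map x) ?size_enum_ord // nth_ord_enum.
rewrite /first_free; set sel := seq.filter _ _.
have mem_sel x : (x \in sel) = (p <= x) && (x \notin occ).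
  by rewrite mem_filter mem_enum andbT.
have : sorted ltn (map val sel).
  apply: (subseq_sorted ltn_trans (map_subseq val (filter_subseq _ _))).
  by rewrite val_enum_ord iota_ltn_sorted.
case def_sel: sel mem_sel => [|q rest] mem_sel /=.
  move=> _; apply/hasPn => y; move: y => [] //=.
  move=> /(nthP false)[i]; rewrite size_drop size_occupancy => lt_i.
  have lt_n : p + i < n by rewrite -ltn_subRL.
  rewrite nth_drop (nthE (Ordinal lt_n)) => free.
  by have := mem_sel (Ordinal lt_n); rewrite free leq_addr.
rewrite (path_sortedE ltn_trans) => /andP[/allP q_min _].
have /andP[pq qocc] : (p <= q) && (q \notin occ) by rewrite -mem_sel mem_head.
have between (s : 'I_n) : p <= s < q -> s \in occ.
  case/andP=> ps sq; apply: contraLR sq => socc; rewrite -leqNgt.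
  have : s \in q :: rest by rewrite mem_sel ps.
  by rewrite inE => /predU1P[->//|/(map_f val)/q_min/ltnW].
have [|i /andP[pi iq]|-> ->] := @fill_first_set_nth (occupancy occ) p q pq.
- by rewrite nthE.
- have lt_i : i < n by apply: ltn_trans (ltn_ord q).
  by rewrite (nthE (Ordinal lt_i)) between //= pi.
split=> //; apply: (@eq_from_nth _ false).
  by rewrite size_set_nth !size_occupancy; apply/maxn_idPr.
rewrite size_set_nth size_occupancy (maxn_idPr _) // => i lt_i.
rewrite nth_set_nth /= -[i]/(val (Ordinal lt_i)) nthE (nth_map q) ?size_enum_ord //.
rewrite nth_ord_enum inE negb_or val_eqE.
by case: eqP.
Qed.

Definition add_counts {n} (l : seq nat) (prefs : seq 'I_n) : seq nat :=
  foldl (fun l (p : 'I_n) => incr_nth l p) l prefs.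

Lemma size_add_counts n l (s : seq 'I_n) : size l = n -> size (add_counts l s) = n.
Proof.
elim: s l => //= p s IH l size_l; apply: IH.
by rewrite size_incr_nth size_l ltn_ord.
Qed.

Lemma sumn_incr_nth l i : sumn (incr_nth l i) = (sumn l).+1.
Proof.
elim: l i => [|c l IH] [|i] //=; last by rewrite IH addnS.
by elim: i.
Qed.

Lemma sumn_add_counts n l (s : seq 'I_n) : sumn (add_counts l s) = sumn l + size s.
Proof.
elim: s l => [|p s IH] l /=; first by rewrite addn0.
by rewrite IH sumn_incr_nth addSnnS.
Qed.

(** Later arrivals cannot undo a failure to park; this settles the failing branch of [parkP]. *)
Lemma overflow_add_counts n l (s : seq 'I_n) : size l = n ->
  overflow 0 l <= overflow 0 (add_counts l s).
Proof.
elim: s l => //= p s IH l size_l; rewrite -/(add_counts _ s).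
apply: leq_trans (IH _ _); last by rewrite size_incr_nth size_l ltn_ord.
by rewrite overflow_incr ?size_l // leq_addr.
Qed.

(** The invariant: [l] counts the preferences of the cars already parked, [occ] holds their spots,
    and the queue leaves exactly the other spots empty. The last clause holds because a car only
    attempts spots that are taken, plus the one it takes. *)
Lemma parkP n (s occ : seq 'I_n) l : size l = n ->
  empties 0 l = occupancy occ -> overflow 0 l = 0 ->
  if park occ s is Some qs then
    [/\ overflow 0 (add_counts l s) = 0,
        empties 0 (add_counts l s) = occupancy (qs ++ occ) &
        forall x : 'I_n, (has (fun car : 'I_n * 'I_n => car.1 <= x <= car.2) (zip s qs))
                    || (x \in occ) = (x \in qs ++ occ)]
  else overflow 0 (add_counts l s) != 0.
Proof.
elim: s occ l => [|p s IH] occ l size_l empties_l overflow_l //=.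
have p_lt : p < size l by rewrite size_l.
have := first_freeP n occ p; case: (first_free occ p) => [q|]; last first.
  rewrite -empties_l => full; rewrite -lt0n.
  apply: leq_trans (overflow_add_counts _ _ _ _); last by rewrite size_incr_nth p_lt.
  by rewrite overflow_incr // full addn1.
move=> [pq qocc between some fillE].
have := IH (q :: occ) (incr_nth l p).
rewrite size_incr_nth p_lt size_l empties_incr // empties_l fillE.
rewrite overflow_incr // empties_l some overflow_l => /(_ erefl erefl erefl).
case: (park (q :: occ) s) => [qs|] //= [-> -> attempt]; split=> //.
  by apply: eq_map => x; rewrite /= !(mem_cat, inE) orbCA.
move=> x; rewrite inE mem_cat.
have := attempt x; rewrite mem_cat inE.
have [xq|nxq] := eqVneq x q.
  by rewrite xq leqnn pq /= !orbT.
(* Apart from [q], all spots this car attempts were already in [occ], so they add nothing. *)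
have -> : (p <= x <= q) = (p <= x < q) by rewrite [x < q]ltn_neqAle nxq.
by case: (boolP (p <= x < q)) => [/between ->|_] //=; rewrite ?orbT.
Qed.

Lemma empties_nseq0 n : empties 0 (nseq n 0) = nseq n true.
Proof. by elim: n => //= n ->. Qed.

Lemma overflow_nseq0 n : overflow 0 (nseq n 0) = 0.
Proof. by elim: n. Qed.

Lemma park_add_counts m n (pi : m.-tuple 'I_n) :
  if park [::] pi is Some qs then
    overflow 0 (add_counts (nseq n 0) pi) = 0 /\
    empties 0 (add_counts (nseq n 0) pi)
      = [seq ~~ attempted pi x | x <- enum 'I_n]
  else overflow 0 (add_counts (nseq n 0) pi) != 0.
Proof.
have : empties 0 (nseq n 0) = occupancy ([::] : seq 'I_n).
  rewrite empties_nseq0; apply: (@eq_from_nth _ true) => [|i].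
    by rewrite size_nseq size_occupancy.
  rewrite size_nseq => lt_i; rewrite nth_nseq lt_i.
  by rewrite (nth_map (Ordinal lt_i)) // size_enum_ord.
move=> /(parkP n pi [::] _ (size_nseq n 0))/(_ (overflow_nseq0 n)).
rewrite /attempted; case: (park [::] pi) => // qs [-> -> attempt]; split=> //.
apply: eq_map => x; congr negb.
by have := attempt x; rewrite orbF.
Qed.

Lemma sumn_add_counts_nseq0 m n (pi : m.-tuple 'I_n) :
  sumn (add_counts (nseq n 0) pi) = m.
Proof. by rewrite sumn_add_counts sumn_nseq size_tuple. Qed.

Lemma PF_feasible m n (pi : m.-tuple 'I_n) :
  (pi \in PF m n) = feasible (add_counts (nseq n 0) pi).
Proof.
have -> : (pi \in PF m n) = (overflow 0 (add_counts (nseq n 0) pi) == 0).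
  by rewrite inE; have := park_add_counts _ _ pi; case: park => [qs [->]|/negPf].
rewrite overflow_eq0 add0n.
by case: (boolP (feasible _)) => [/sumn_feasible ->|]; rewrite ?andbF.
Qed.

Lemma unattempted_spotE m n (pi : m.-tuple 'I_n) i :
  pi \in PF m n -> 0 < i -> i + m <= n ->
  unattempted_spot i pi = i + excess i (add_counts (nseq n 0) pi).
Proof.
rewrite inE => pi_PF; case: i => // i _ le_i.
have := park_add_counts _ _ pi; case: park pi_PF => // qs _ [overflow0 emptiesE].
have size_l : size (add_counts (nseq n 0) pi) = n by rewrite size_add_counts ?size_nseq.
rewrite /unattempted_spot /unattempted filter_mask -emptiesE map_mask.
have -> : [seq (val s).+1 | s <- enum 'I_n] = iota 1 n.
  by rewrite (map_comp S val) val_enum_ord -(iotaDl 1).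
rewrite -[in iota 1 n]size_l nth_empties ?addn0 //.
have := count_empties _ _ overflow0.
by rewrite sumn_add_counts_nseq0 size_l addn0; move: le_i; lia.
Qed.

Local Open Scope classical_set_scope.
Local Open Scope ring_scope.

(** * Summation over parking functions *)

(** The sum over all preference sequences, taken one car at a time, which allows induction on the
    number of cars. *)
Fixpoint counts_sum {R : nmodType} (n m : nat) (F : seq nat -> R) (l : seq nat) : R :=
  if m is m'.+1 then \sum_(p < n) counts_sum n m' F (incr_nth l p) else F l.

Lemma sum_add_counts (R : nmodType) n m (F : seq nat -> R) l :
  \sum_(pi : m.-tuple 'I_n) F (add_counts l pi) = counts_sum n m F l.
Proof.
elim: m l => [|m IH] l /=.
  by rewrite (big_pred1 [tuple]) //= => t; rewrite (tuple0 t) /=; apply/esym/eqP; apply: val_inj.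
under [RHS]eq_bigr => p _ do rewrite -IH.
rewrite pair_big /= (reindex (fun x : 'I_n * m.-tuple 'I_n => cons_tuple x.1 x.2)) //=.
exists (fun t : m.+1.-tuple 'I_n => (thead t, [tuple of behead t])).
  by move=> [p t] _ /=; congr pair; apply: val_inj.
by move=> t _; rewrite [RHS]tuple_eta.
Qed.

Lemma eq_counts_sum (R : nmodType) n m (F G : seq nat -> R) l : size l = n ->
  (forall l', size l' = n -> sumn l' = (sumn l + m)%N -> F l' = G l') ->
  counts_sum n m F l = counts_sum n m G l.
Proof.
elim: m l => [|m IH] l /= size_l FG; first by rewrite FG ?addn0.
apply: eq_bigr => p _; apply: IH; first by rewrite size_incr_nth size_l ltn_ord.
by move=> l' sz; rewrite sumn_incr_nth addSnnS; apply: FG.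
Qed.

Lemma counts_sumD (R : nmodType) n m (F G : seq nat -> R) l :
  counts_sum n m (fun l => F l + G l) l = counts_sum n m F l + counts_sum n m G l.
Proof.
elim: m l => //= m IH l; rewrite -big_split.
by apply: eq_bigr => p _; rewrite IH.
Qed.

Lemma counts_sumZ (R : pzRingType) n m a (F : seq nat -> R) l :
  counts_sum n m (fun l => a * F l) l = a * counts_sum n m F l.
Proof.
elim: m l => //= m IH l; rewrite mulr_sumr.
by apply: eq_bigr => p _; rewrite IH.
Qed.

(** The binomial coefficient chooses which [c] of the [m] cars prefer the first spot. The induction
    separates the case where the first car does so, and Pascal's rule recombines the two cases. *)
Lemma counts_sum_first (R : pzRingType) n m (F : seq nat -> R) a l :
  counts_sum n.+1 m F (a :: l) =
  \sum_(c < m.+1) 'C(m, c)%:R * counts_sum n (m - c) (fun l' => F ((a + c)%N :: l')) l.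
Proof.
elim: m a l => [|m IH] a l; first by rewrite big_ord1 bin0 mul1r addn0.
rewrite [LHS]/= big_ord_recl /= IH.
under [X in _ + X]eq_bigr => p _ do rewrite /= IH.
rewrite exchange_big /=.
under [X in _ + X]eq_bigr => c _ do rewrite -mulr_sumr.
rewrite [RHS]big_ord_recl bin0 mul1r subn0 addn0 /=.
under [X in _ = _ + X]eq_bigr => c _ do
  rewrite /bump leq0n add1n subSS binS natrD mulrDl.
rewrite big_split /= [X in _ = _ + X]addrC addrCA; congr (_ + _).
  by apply: eq_bigr => c _; rewrite addSnnS.
rewrite big_ord_recl /= bin0 mul1r subn0 addn0; congr (_ + _).
rewrite [RHS]big_ord_recr /= bin_small // mul0r addr0.
apply: eq_bigr => c _; rewrite /bump leq0n add1n; congr (_ * _).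
by rewrite -[in RHS](subnSK (ltn_ord c)).
Qed.

Definition feasible_sum {R : pzRingType} (n m : nat) (F : seq nat -> R) : R :=
  counts_sum n m (fun l => (feasible l)%:R * F l) (nseq n 0%N).

(** The counts always sum to [m], so [m <= n.+1] makes the head condition of [feasible] automatic
    and only the tail is constrained. *)
Lemma feasible_sum_first (R : pzRingType) n m (F : seq nat -> R) : (m <= n.+1)%N ->
  feasible_sum n.+1 m F =
  \sum_(c < m.+1) 'C(m, c)%:R * feasible_sum n (m - c) (fun l => F (val c :: l)).
Proof.
move=> le_mn; rewrite /feasible_sum /= counts_sum_first.
apply: eq_bigr => c _; congr (_ * _).
apply: eq_counts_sum => [|l size_l sumn_l]; first by rewrite size_nseq.
rewrite add0n /= size_l sumn_l sumn_nseq mul0n add0n subnKC ?le_mn //.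
by rewrite -ltnS.
Qed.

(** * Falling terms and the binomial theorem *)

Definition fall_term (M m k : nat) : nat := (M ^ (m - k) * m ^_ k)%N.

Lemma fall_termSS M m k : fall_term M m.+1 k.+1 = (m.+1 * fall_term M m k)%N.
Proof. by rewrite /fall_term subSS ffactSS mulnCA. Qed.

Lemma fall_term_small M m k : (m < k)%N -> fall_term M m k = 0%N.
Proof. by move=> lt_mk; rewrite /fall_term ffact_small ?muln0. Qed.

(** Both sides place [m] cars on [M.+1] spots with [k + p] distinct cars marked in order, the last
    [p] of them being on the new spot and the first [k] carrying no choice of spot. In the proof,
    absorption identities for binomial coefficients lower [p] and then [k], down to the binomial
    theorem. *)
Lemma fall_term_binomial M m k p :
  (\sum_(c < m.+1) 'C(m, c) * c ^_ p * fall_term M (m - c) k = fall_term M.+1 m (k + p))%N.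
Proof.
elim: p m => [|p IHp] [|m].
- by rewrite big_ord1 addn0 /fall_term; case: k.
- rewrite addn0; elim: k (m.+1) => [|k IHk] [|m'].
  + by rewrite big_ord1.
  + rewrite /fall_term subn0 muln1 -[M.+1]addn1 expnDn; apply: eq_bigr => c _.
    by rewrite ffactn0 subn0 exp1n !muln1.
  + by rewrite big_ord1 !fall_term_small.
  rewrite fall_termSS -IHk big_distrr big_ord_recr /= subnn (fall_term_small _ 0) // muln0 addn0.
  apply: eq_bigr => c _; rewrite !ffactn0 !muln1 subSn -1?ltnS // fall_termSS.
  by rewrite 2!mulnA -subSn -1?ltnS // [('C(_, _) * (_ - _))%N]mulnC -mul_bin_down.
- by rewrite big_ord1 ffact0n muln0 mul0n addnS fall_term_small.
rewrite addnS fall_termSS -IHp big_distrr big_ord_recl ffact0n muln0 add0n.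
apply: eq_bigr => c _; rewrite lift0 subSS ffactSS mulnA.
by rewrite [('C(_, _) * _.+1)%N]mulnC -mul_bin_diag /= -!mulnA.
Qed.

(* [B] is any bound above [m], kept separate so that it does not change along the
   recursion, where [m] decreases. *)
Definition fall_comb {R : pzRingType} (B M m : nat) (g : nat -> R) : R :=
  \sum_(k < B) g k * (fall_term M m k)%:R.

Lemma eq_fall_comb (R : pzRingType) B M m (f g : nat -> R) :
  f =1 g -> fall_comb B M m f = fall_comb B M m g.
Proof. by move=> fg; apply: eq_bigr => k _; rewrite fg. Qed.

Lemma fall_combD (R : pzRingType) B M m (f g : nat -> R) :
  fall_comb B M m (fun k => f k + g k) = fall_comb B M m f + fall_comb B M m g.
Proof. by rewrite -big_split; apply: eq_bigr => k _; rewrite mulrDl. Qed.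

Lemma fall_combZ (R : pzRingType) B M m a (f : nat -> R) :
  fall_comb B M m (fun k => a * f k) = a * fall_comb B M m f.
Proof. by rewrite mulr_sumr; apply: eq_bigr => k _; rewrite mulrA. Qed.

(** This is how one step of the recursion acts on coefficients: a weight [c ^_ p] shifts them by [p]
    while [M] becomes [M.+1]. *)
Lemma fall_comb_binomial (R : comPzRingType) B M m p (g : nat -> R) : (m < B)%N ->
  \sum_(c < m.+1) 'C(m, c)%:R * ((c ^_ p)%:R * fall_comb B M (m - c) g) =
  fall_comb B M.+1 m (fun k => if (k < p)%N then 0 else g (k - p)%N).
Proof.
move=> lt_mB.
transitivity (\sum_(k < B) g k * (fall_term M.+1 m (k + p))%:R).
  under eq_bigr => c _ do rewrite 2!mulr_sumr.
  rewrite exchange_big; apply: eq_bigr => k _; rewrite -fall_term_binomial.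
  rewrite natr_sum mulr_sumr; apply: eq_bigr => c _.
  by rewrite !natrM; ring.
rewrite -(big_mkord xpredT (fun k => g k * (fall_term M.+1 m (k + p))%:R)).
rewrite /fall_comb -(big_mkord xpredT (fun k =>
  (if (k < p)%N then 0 else g (k - p)%N) * (fall_term M.+1 m k)%:R)).
have zero a b : (B <= a)%N ->
    \sum_(a <= k < b) (if (k < p)%N then 0 else g (k - p)%N) * (fall_term M.+1 m k)%:R = 0.
  move=> le_Ba; rewrite big_nat_cond big1 // => k /andP[/andP[le_ak _] _].
  by rewrite fall_term_small ?mulr0 //; apply: leq_trans le_ak; apply: leq_trans le_Ba.
(* Both sums extend to the range below [B + p]: the added terms have [k >= B > m], where [fall_term]
   vanishes. *)
transitivity (\sum_(0 <= k < B + p)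
  (if (k < p)%N then 0 else g (k - p)%N) * (fall_term M.+1 m k)%:R).
  rewrite [RHS](big_cat_nat (n := p)) ?leq_addl //=.
  rewrite [X in _ = X + _]big_nat_cond [X in _ = X + _]big1 ?add0r; last first.
    by move=> k /andP[/andP[_ ->] _]; rewrite mul0r.
  rewrite -[X in _ = \sum_(X <= _ < _) _]add0n big_addn addnK; apply: eq_bigr => k _.
  by rewrite ltnNge leq_addl /= addnK.
by rewrite [LHS](big_cat_nat (n := B)) ?leq_addr //= [X in _ + X]zero // addr0.
Qed.

(** * Closed forms for sums over parking functions *)

Lemma feasible_sum_ge (R : pzRingType) n m (F : seq nat -> R) : (n < m)%N ->
  feasible_sum n m F = 0.
Proof.
move=> lt_nm; rewrite -[RHS](mul0r (feasible_sum n m F)) -counts_sumZ.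
apply: eq_counts_sum => [|l size_l sumn_l]; first by rewrite size_nseq.
have /negPf -> : ~~ feasible l; last by rewrite !mul0r.
apply/negP => /sumn_feasible.
by rewrite size_l sumn_l sumn_nseq mul0n add0n leqNgt lt_nm.
Qed.

Lemma feasible_sumD (R : pzRingType) n m (F G : seq nat -> R) :
  feasible_sum n m (fun l => F l + G l) = feasible_sum n m F + feasible_sum n m G.
Proof.
rewrite -counts_sumD; apply: eq_counts_sum => [|l _ _].
  by rewrite size_nseq.
by rewrite mulrDr.
Qed.

Lemma feasible_sumZ (R : comPzRingType) n m a (F : seq nat -> R) :
  feasible_sum n m (fun l => a * F l) = a * feasible_sum n m F.
Proof.
rewrite -counts_sumZ; apply: eq_counts_sum => [|l _ _].
  by rewrite size_nseq.
by rewrite mulrCA.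
Qed.

Lemma eq_feasible_sum (R : pzRingType) n m (F G : seq nat -> R) :
  F =1 G -> feasible_sum n m F = feasible_sum n m G.
Proof.
move=> FG; apply: eq_counts_sum => [|l _ _]; first by rewrite size_nseq.
by rewrite FG.
Qed.

Lemma fall_comb_delta (R : pzRingType) B M m a : (m < B)%N ->
  fall_comb B M m (fun k => (k == a)%:R : R) = (fall_term M m a)%:R.
Proof.
move=> lt_mB; rewrite /fall_comb; have [lt_aB|le_Ba] := ltnP a B.
  rewrite (bigD1 (Ordinal lt_aB)) //= eqxx mul1r big1 ?addr0 // => k.
  by rewrite -val_eqE /= => /negPf->; rewrite mul0r.
rewrite fall_term_small ?(leq_trans lt_mB) // big1 // => k _.
by rewrite ltn_eqF ?mul0r // (leq_trans _ le_Ba).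
Qed.

Definition count_coef {R : pzRingType} (k : nat) : R :=
  (k == 0%N)%:R - (k == 1%N)%:R.

Lemma fall_comb_count (R : pzRingType) B M m : (m < B)%N ->
  fall_comb B M m count_coef = (fall_term M m 0)%:R - (fall_term M m 1)%:R :> R.
Proof.
move=> lt_mB; rewrite -!(fall_comb_delta R B) // -[in RHS]mulN1r -fall_combZ -fall_combD.
by apply: eq_fall_comb => k; rewrite mulN1r.
Qed.

Lemma fall_term_diag m : fall_term m.+1 m.+1 0 = fall_term m.+1 m.+1 1.
Proof. by rewrite /fall_term subn0 subSS subn0 muln1 ffactn1 expnSr. Qed.

(** The case [m = n.+1] must be included: the term [c = 0] of the recursion lowers [n] but keeps
    [m]. No parking function exists there, and the formula agrees since V_0 = V_1 by
    [fall_term_diag]. *)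
Lemma feasible_sum1 (R : comPzRingType) B n m : (m < B)%N -> (m <= n.+1)%N ->
  feasible_sum n m (fun=> 1 : R) = fall_comb B n.+1 m count_coef.
Proof.
elim: n m => [|n IH] m lt_mB le_mn.
  rewrite fall_comb_count //; case: m lt_mB le_mn => [|[|//]] _ _.
    by rewrite /feasible_sum /= mul1r subr0.
  by rewrite fall_term_diag subrr feasible_sum_ge.
move: le_mn; rewrite leq_eqVlt ltnS => /predU1P[eq_m|le_mn].
  by rewrite fall_comb_count // eq_m fall_term_diag subrr feasible_sum_ge.
rewrite feasible_sum_first //.
transitivity (\sum_(c < m.+1) 'C(m, c)%:R *
    ((c ^_ 0)%:R * fall_comb B n.+1 (m - c) count_coef : R)).
  by apply: eq_bigr => c _; rewrite ffactn0 mul1r IH //; lia.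
by rewrite fall_comb_binomial //; apply: eq_fall_comb => k; rewrite subn0.
Qed.

(** The recursion replaces [i.+1] by [i + c] and [m] by [m - c], so the bound [i + m <= n] is
    preserved. *)
Lemma feasible_sum_excess (R : comPzRingType) B n m i : (m < B)%N ->
  (i + m <= n)%N ->
  feasible_sum n m (fun l => (excess i l)%:R : R)
  = fall_comb B n.+1 m (fun k => i%:R * (k == 1%N)%:R).
Proof.
elim: n m i => [|n IH] m [|i] lt_mB le_imn; try by [].
- transitivity (feasible_sum 0 m (fun l => 0 * 1 : R)).
    by apply: eq_feasible_sum => l; rewrite excess0 mul0r.
  by rewrite feasible_sumZ mul0r fall_combZ mul0r.
- transitivity (feasible_sum n.+1 m (fun l => 0 * 1 : R)).
    by apply: eq_feasible_sum => l; rewrite excess0 mul0r.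
  by rewrite feasible_sumZ mul0r fall_combZ mul0r.
have le_mn : (m <= n.+1)%N by move: le_imn; lia.
rewrite feasible_sum_first //.
(* Here c (V_0 - V_1) + (i + c) V_1 = i V_1 + c V_0, and the weight c shifts V_0 to V_1. *)
transitivity (\sum_(c < m.+1) 'C(m, c)%:R *
  ((c ^_ 0)%:R * fall_comb B n.+1 (m - c) (fun k => i%:R * (k == 1%N)%:R : R)
   + (c ^_ 1)%:R * fall_comb B n.+1 (m - c) (fun k => (k == 0%N)%:R : R))).
  apply: eq_bigr => c _; congr (_ * _).
  have le_cm : (c <= m)%N by rewrite -ltnS.
  transitivity (c%:R * feasible_sum n (m - c) (fun=> 1 : R)
    + feasible_sum n (m - c) (fun l => (excess (i + c) l)%:R)).
    rewrite -feasible_sumZ -feasible_sumD.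
    by apply: eq_feasible_sum => l; rewrite /= natrD mulr1.
  rewrite (feasible_sum1 _ B) ?(IH _ (i + c)%N); try lia.
  rewrite ffactn0 mul1r ffactn1 -!fall_combZ -!fall_combD.
  by apply: eq_fall_comb => k; rewrite /count_coef natrD; ring.
under eq_bigr => c _ do rewrite mulrDr.
rewrite big_split /= !fall_comb_binomial // -fall_combD; apply: eq_fall_comb => k.
by case: k => [|[|k]] /=; rewrite ?subn0 -?natr1 /=; ring.
Qed.

Lemma feasible_sum_excess2 (R : comPzRingType) B n m i j : (m < B)%N ->
  (i <= j)%N -> (j + m <= n)%N ->
  feasible_sum n m (fun l => (excess i l)%:R * (excess j l)%:R : R)
  = fall_comb B n.+1 m (fun k => i%:R * j%:R * (1 < k)%N%:R + i%:R * k%:R).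
Proof.
elim: n m i j => [|n IH] m [|i] j lt_mB le_ij le_jmn.
- rewrite /fall_comb big1 => [|k _]; last by ring.
  by rewrite -(mul0r (feasible_sum 0 m (fun=> 1))) -feasible_sumZ;
    apply: eq_feasible_sum => l; rewrite excess0 !mul0r.
- by move: (leq_trans le_ij (leq_trans (leq_addr _ _) le_jmn)).
- rewrite /fall_comb big1 => [|k _]; last by ring.
  by rewrite -(mul0r (feasible_sum n.+1 m (fun=> 1))) -feasible_sumZ;
    apply: eq_feasible_sum => l; rewrite excess0 !mul0r.
case: j le_ij le_jmn => // j le_ij le_jmn.
have le_mn : (m <= n.+1)%N by move: le_jmn; lia.
rewrite feasible_sum_first //.
(* The product (c + e_(i+c)) (c + e_(j+c)) is expanded and sorted by falling factorials of c, using
   c^2 = c (c - 1) + c, to fit [fall_comb_binomial]. *)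
transitivity (\sum_(c < m.+1) 'C(m, c)%:R *
  ((c ^_ 0)%:R * fall_comb B n.+1 (m - c) (fun k => i%:R * j%:R * (1 < k)%N%:R + i%:R * k%:R : R)
   + (c ^_ 1)%:R * fall_comb B n.+1 (m - c)
       (fun k => (k == 0%N)%:R + (i + j).+1%:R * (0 < k)%N%:R + k%:R : R)
   + (c ^_ 2)%:R * fall_comb B n.+1 (m - c) (fun=> 1))).
  apply: eq_bigr => c _; congr (_ * _).
  have le_cm : (c <= m)%N by rewrite -ltnS.
  transitivity (c%:R ^+ 2 * feasible_sum n (m - c) (fun=> 1 : R)
    + c%:R * feasible_sum n (m - c) (fun l => (excess (i + c) l)%:R)
    + c%:R * feasible_sum n (m - c) (fun l => (excess (j + c) l)%:R)
    + feasible_sum n (m - c) (fun l => (excess (i + c) l)%:R * (excess (j + c) l)%:R)).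
    rewrite -!feasible_sumZ -!feasible_sumD.
    by apply: eq_feasible_sum => l; rewrite /= !natrD; ring.
  rewrite (feasible_sum1 _ B) ?(IH _ (i + c)%N) ?(feasible_sum_excess _ B _ _ (i + c)%N)
     ?(feasible_sum_excess _ B _ _ (j + c)%N); try lia.
  rewrite -!fall_combZ -!fall_combD.
  have sqE : c%:R ^+ 2 = (c ^_ 2)%:R + c%:R :> R.
    by case: (val c) => [|x]; rewrite ?expr0n ?addr0 // ffactnS ffactn1 natrM -natr1; ring.
  have -> : (c ^_ 2)%:R = c%:R ^+ 2 - c%:R :> R by rewrite sqE addrK.
  apply: eq_fall_comb => k; rewrite /count_coef ffactn0 ffactn1 -[(i + j).+1%:R]natr1 !natrD.
  by case: k => [|[|k]] /=; rewrite ?subn0 -?natr1 /=; ring.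
under eq_bigr => c _ do rewrite 2!mulrDr.
rewrite 2!big_split /= !fall_comb_binomial // -!fall_combD; apply: eq_fall_comb => k.
by case: k => [|[|k]] /=; rewrite ?subn0 ?subnn -?natr1 ?natrD /=; ring.
Qed.

(** * Exact covariances *)

Lemma sum_PF (R : pzRingType) m n (F : seq nat -> R) :
  \sum_(pi in PF m n) F (add_counts (nseq n 0%N) pi) = feasible_sum n m F.
Proof.
rewrite /feasible_sum -sum_add_counts big_mkcond; apply: eq_bigr => pi _.
by rewrite PF_feasible; case: feasible; rewrite ?mul1r ?mul0r.
Qed.

(* This is [fall_term M m k] divided by [M ^ m] (for [0 < M]). *)
Definition fall_ratio {R : fieldType} (M m k : nat) : R :=
  (m ^_ k)%:R / M%:R ^+ k.

Definition fall_sum {R : fieldType} (M m : nat) (g : nat -> R) : R :=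
  \sum_(k < m.+1) g k * fall_ratio M m k.

Lemma fall_comb_fall_sum (R : numFieldType) M m (g : nat -> R) : (0 < M)%N ->
  fall_comb m.+1 M m g = M%:R ^+ m * fall_sum M m g.
Proof.
move=> M_gt0; rewrite mulr_sumr; apply: eq_bigr => k _.
have M_neq0 : M%:R != 0 :> R by rewrite pnatr_eq0 -lt0n.
have -> : M%:R ^+ m = M%:R ^+ (m - k) * M%:R ^+ k :> R by rewrite -exprD subnK -1?ltnS.
by rewrite /fall_term natrM natrX /fall_ratio; field; rewrite expf_neq0.
Qed.

(** This is the recursion f_(k+1) = (m/M - k/M) f_k summed against [g]. Choosing [g] as a power of k
    relates consecutive moments. *)
Lemma fall_sum_shift (R : numFieldType) M m (g : nat -> R) : (0 < M)%N ->
  fall_sum M m g =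
  g 0%N + fall_sum M m (fun k => g k.+1 * (m%:R / M%:R - k%:R / M%:R)).
Proof.
move=> M_gt0; have M_neq0 : M%:R != 0 :> R by rewrite pnatr_eq0 -lt0n.
rewrite /fall_sum big_ord_recl {1}/fall_ratio ffactn0 expr0 divr1 mulr1; congr +%R.
(* The shifted sum has one extra term, at k = m, where the factor m/M - k/M is zero. *)
rewrite [RHS]big_ord_recr /= -mulrBl subrr mul0r mulr0 mul0r addr0.
apply: eq_bigr => k _; rewrite /bump add1n -mulrA; congr (_ * _).
rewrite /fall_ratio ffactnSr natrM natrB 1?ltnW // exprSr.
by field; rewrite expf_neq0.
Qed.

Lemma fall_sumD (R : numFieldType) M m (f g : nat -> R) :
  fall_sum M m (fun k => f k + g k) = fall_sum M m f + fall_sum M m g.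
Proof.
by rewrite /fall_sum -big_split; apply: eq_bigr => k _ /=; rewrite mulrDl.
Qed.

Lemma fall_sumZ (R : numFieldType) M m a (f : nat -> R) :
  fall_sum M m (fun k => a * f k) = a * fall_sum M m f.
Proof. by rewrite mulr_sumr; apply: eq_bigr => k _; rewrite -mulrA. Qed.

Lemma eq_fall_sum (R : numFieldType) M m (f g : nat -> R) :
  f =1 g -> fall_sum M m f = fall_sum M m g.
Proof. by move=> fg; apply: eq_bigr => k _; rewrite fg. Qed.

Definition fall_moment {R : fieldType} (M m p : nat) : R :=
  fall_sum M m (fun k => k%:R ^+ p).

Lemma fall_moment_ge0 (R : numFieldType) M m p : 0 <= fall_moment M m p :> R.
Proof.
by apply: sumr_ge0 => k _; rewrite mulr_ge0 ?divr_ge0 ?exprn_ge0.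
Qed.

Lemma fall_moment0 (R : numFieldType) M m : (0 < M)%N ->
  fall_moment M m 0 * (1 - m%:R / M%:R) = 1 - fall_moment M m 1 / M%:R :> R.
Proof.
move=> M_gt0; suff E : fall_moment M m 0 = 1 + (m%:R / M%:R * fall_moment M m 0
    + - M%:R^-1 * fall_moment M m 1) :> R.
  by rewrite mulrBr {1}E; ring.
rewrite {1}/fall_moment fall_sum_shift // expr0 -!fall_sumZ -fall_sumD.
by congr +%R; apply: eq_fall_sum => k; rewrite !expr0; ring.
Qed.

Lemma fall_moment1 (R : numFieldType) M m : (0 < M)%N ->
  fall_moment M m 1 * (1 - m%:R / M%:R) =
  m%:R / M%:R * fall_moment M m 0
  - (fall_moment M m 2 + fall_moment M m 1) / M%:R :> R.
Proof.
move=> M_gt0; suff E : fall_moment M m 1 =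
    m%:R / M%:R * fall_moment M m 1 + m%:R / M%:R * fall_moment M m 0
    + (- M%:R^-1 * fall_moment M m 2 + - M%:R^-1 * fall_moment M m 1) :> R.
  by rewrite mulrBr {1}E; ring.
rewrite {1}/fall_moment fall_sum_shift // expr0n add0r -!fall_sumZ -!fall_sumD.
by apply: eq_fall_sum => k; rewrite -natr1; ring.
Qed.

(** An exact identity would involve the third moment; dropping the negative term -(k + 1)^2 k/M
    closes the hierarchy with an inequality. *)
Lemma fall_moment2_le (R : numFieldType) M m : (0 < M)%N ->
  fall_moment M m 2 * (1 - m%:R / M%:R) <=
  m%:R / M%:R * (2 * fall_moment M m 1 + fall_moment M m 0) :> R.
Proof.
move=> M_gt0; suff E : fall_moment M m 2 <=
    m%:R / M%:R * fall_moment M m 2 + (m%:R / M%:R * 2 * fall_moment M m 1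
    + m%:R / M%:R * fall_moment M m 0) :> R.
  rewrite mulrBr mulr1 lerBlDr; apply: le_trans E _.
  by rewrite le_eqVlt; apply/orP; left; apply/eqP; ring.
rewrite {1}/fall_moment fall_sum_shift // expr0n add0r -!fall_sumZ -!fall_sumD.
apply: ler_sum => k _; apply: ler_wpM2r; first by rewrite divr_ge0 ?exprn_ge0.
rewrite -natr1 -subr_ge0 (_ : _ - _ = (k%:R + 1) ^+ 2 * (k%:R / M%:R)); last by ring.
by rewrite mulr_ge0 ?divr_ge0 ?exprn_ge0 ?addr_ge0.
Qed.

Lemma PF_cov_shift (R : realType) m n (X Y X' Y' : m.-tuple 'I_n -> R) a b :
  #|PF m n|%:R != 0 :> R ->
  (forall pi, pi \in PF m n -> X pi = a + X' pi) ->
  (forall pi, pi \in PF m n -> Y pi = b + Y' pi) ->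
  PF_cov X Y =
  PF_mean (fun pi => X' pi * Y' pi) - PF_mean X' * PF_mean Y'.
Proof.
move=> U0 XE YE.
have mean_shift Z Z' (e : R) : (forall pi, pi \in PF m n -> Z pi = e + Z' pi) ->
    PF_mean Z = e + PF_mean Z'.
  move=> ZE; rewrite /PF_mean (eq_bigr _ ZE) big_split sumr_const /=.
  by rewrite mulrDl -[e *+ _]mulr_natr mulfK.
rewrite /PF_cov (mean_shift _ _ _ XE) (mean_shift _ _ _ YE).
set p := PF_mean X'; set q := PF_mean Y'; rewrite {1}/PF_mean.
rewrite (eq_bigr (fun pi => X' pi * Y' pi + (- q * X' pi + (- p * Y' pi + p * q)))); last first.
  by move=> pi pi_PF; rewrite XE // YE //; ring.
have : \sum_(pi in PF m n) Y' pi = q * #|PF m n|%:R by rewrite /q /PF_mean divfK.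
have : \sum_(pi in PF m n) X' pi = p * #|PF m n|%:R by rewrite /p /PF_mean divfK.
move: p q => p q sumX sumY.
rewrite !big_split /= -!mulr_sumr sumX sumY sumr_const -[q *+ _]mulr_natr /PF_mean.
by field.
Qed.

(** With x = m/M, the second moment of the excesses contributes ij (Q0 - 1 - x) + i Q1 over 1 - x.
    Eliminating Q0 by [fall_moment0] cancels the product of means up to a term of order 1/M.
    Equality of [i] and [j] is allowed, to cover the variance. *)
Lemma cov_kE (R : realType) m n i j : (0 < i)%N -> (i <= j)%N -> (j + m <= n)%N ->
  cov_k R m n i j =
  i%:R * fall_moment n.+1 m 1 / (1 - m%:R / n.+1%:R)
  * (1 - j%:R / n.+1%:R / (1 - m%:R / n.+1%:R)).
Proof.
move=> i_gt0 le_ij le_jmn.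
have M_neq0 : n.+1%:R != 0 :> R by rewrite pnatr_eq0.
set x := m%:R / n.+1%:R.
have x_neq1 : 1 - x != 0.
  rewrite subr_eq0 eq_sym /x; apply/eqP => /divr1_eq /eqP.
  by rewrite eqr_nat; move: le_jmn; lia.
pose W := n.+1%:R ^+ m : R; have W_neq0 : W != 0 by rewrite expf_neq0.
have ab0 : (fall_term n.+1 m 0)%:R = W by rewrite /fall_term subn0 ffactn0 muln1 natrX.
have ab1 : (fall_term n.+1 m 1)%:R = W * x.
  rewrite /fall_term ffactn1 natrM natrX /W /x.
  by case: (m) => [|m']; rewrite ?mul0r ?mulr0 // subSS subn0 exprSr; field.
have U_E : #|PF m n|%:R = W * (1 - x).
  rewrite -sum1_card natr_sum (sum_PF R m n (fun=> 1)) (feasible_sum1 _ m.+1) //; last by lia.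
  by rewrite fall_comb_count // ab0 ab1; ring.
have U_neq0 : #|PF m n|%:R != 0 :> R by rewrite U_E mulf_neq0.
pose e l (pi : m.-tuple 'I_n) : R := (excess l (add_counts (nseq n 0%N) pi))%:R.
have kE l (pi : m.-tuple 'I_n) : (0 < l)%N -> (l + m <= n)%N -> pi \in PF m n ->
    (unattempted_spot l pi)%:R = l%:R + e l pi.
  by move=> l_gt0 le_l pi_PF; rewrite unattempted_spotE // natrD.
have meanE l : (l + m <= n)%N -> PF_mean (e l) = l%:R * x / (1 - x).
  move=> le_l; rewrite /PF_mean U_E (sum_PF R m n (fun s => (excess l s)%:R)).
  rewrite (feasible_sum_excess _ m.+1) // fall_combZ fall_comb_delta // ab1.
  by field; rewrite x_neq1 W_neq0.
rewrite /cov_k (PF_cov_shift _ _ _ _ _ (e i) (e j) i%:R j%:R) //; last first.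
- by move=> pi; apply: kE => //; lia.
- by move=> pi; apply: kE => //; lia.
rewrite !meanE //; last by lia.
rewrite /PF_mean U_E (sum_PF R m n (fun s => (excess i s)%:R * (excess j s)%:R)).
rewrite (feasible_sum_excess2 _ m.+1) //.
(* The indicator of k >= 2 is written as 1 - [k = 0] - [k = 1], so that only moments and single
   terms remain. *)
rewrite (eq_fall_comb _ _ _ _ _ (fun k : nat => i%:R * j%:R * k%:R ^+ 0 + (i%:R * k%:R ^+ 1
   + (- (i%:R * j%:R) * (k == 0%N)%:R + - (i%:R * j%:R) * (k == 1%N)%:R)))); last first.
  by case=> [|[|k]] /=; ring.
rewrite 3!fall_combD !fall_combZ !fall_comb_delta // !fall_comb_fall_sum // ab0 ab1.
have := fall_moment0 R n.+1 m isT; rewrite -/x.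
rewrite -!/(fall_moment _ _ _) -/W.
set Q0 := fall_moment _ _ 0; set Q1 := fall_moment _ _ 1 => Q0E.
have -> : Q0 = (1 - Q1 / n.+1%:R) / (1 - x) by rewrite -Q0E mulfK.
clearbody W x Q0 Q1; move: (n.+1%:R : R) M_neq0 => M M_neq0.
by field; rewrite x_neq1 W_neq0 M_neq0.
Qed.

(** * Limits *)

(** With d = 1 - c <= 1, the moments satisfy Q0 <= 1/d, Q1 <= Q0/d and Q2 <= (2 Q1 + Q0)/d <= 3/d^3;
    the constant serves for all three. *)
Lemma fall_moment_bounded (R : realFieldType) (c : R) M m p :
  (0 < M)%N -> m%:R <= c * M%:R -> c < 1 -> (p <= 2)%N ->
  fall_moment M m p <= 3 / (1 - c) ^+ 3.
Proof.
move=> M_gt0 le_mcM c_lt1 le_p2; have M_gt0' : 0 < M%:R :> R by rewrite ltr0n.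
set x := m%:R / M%:R : R; set d := 1 - c.
have x_ge0 : 0 <= x by rewrite divr_ge0.
have x_le_c : x <= c by rewrite ler_pdivrMr.
have d_gt0 : 0 < d by rewrite subr_gt0.
have d_le1 : d <= 1 by rewrite lerBlDr lerDl (le_trans x_ge0).
have Q0_ge0 := fall_moment_ge0 R M m 0.
have Q1_ge0 := fall_moment_ge0 R M m 1.
have Q2_ge0 := fall_moment_ge0 R M m 2.
have dx_ge0 : 0 <= 1 - x - d by rewrite /d; move: x_le_c; lra.
have step Q Q' : 0 <= Q -> 0 <= Q' -> Q * (1 - x) <= x * Q' -> Q * d <= Q'.
  move=> Q_ge0 Q'_ge0 leQ; apply: le_trans (le_trans _ leQ) _.
    by rewrite ler_wpM2l // -subr_ge0.
  by rewrite ler_piMl // (le_trans x_le_c) // ltW.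
have le0 : fall_moment M m 0 * d <= 1.
  apply: (@le_trans _ _ (fall_moment M m 0 * (1 - x))).
    by rewrite ler_wpM2l // -subr_ge0.
  by rewrite fall_moment0 // gerBl divr_ge0.
have le1 : fall_moment M m 1 * d <= fall_moment M m 0.
  by apply: step => //; rewrite fall_moment1 // gerBl divr_ge0 // addr_ge0.
have le2 : fall_moment M m 2 * d <= 2 * fall_moment M m 1 + fall_moment M m 0.
  by apply: step => //; [rewrite addr_ge0 // mulr_ge0|exact: fall_moment2_le].
rewrite ler_pdivlMr ?exprn_gt0 //.
have d_ge0 := ltW d_gt0; have d2_ge0 : 0 <= d ^+ 2 by rewrite exprn_ge0.
have := ler_wpM2r d_ge0 d_le1; have := ler_wpM2r d_ge0 le0; have := ler_wpM2r d_ge0 le1.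
have := ler_wpM2r d2_ge0 le0; have := ler_wpM2r d2_ge0 le1; have := ler_wpM2r d2_ge0 le2.
by case: p le_p2 => [|[|[|//]]] _; clearbody d; lra.
Qed.

Lemma cvg_bounded_div (R : realType) (u : nat -> R) K :
  (forall n, 0 <= u n <= K) -> u n / n.+1%:R @[n --> \oo] --> (0 : R).
Proof.
move=> uK; apply: (squeeze_cvgr (f := fun=> 0) (h := fun n => K * n.+1%:R^-1)).
- by apply: nearW => n; have /andP[u0 uk] := uK n; rewrite divr_ge0 // ler_wpM2r.
- exact: cvg_cst.
- rewrite -[X in _ --> X](mulr0 K); apply: cvgM; [exact: cvg_cst|exact: cvg_harmonic].
Qed.

Lemma cvg_truncn_ratio (R : realType) (c : R) : 0 <= c ->
  (Num.truncn (c * n%:R))%:R / n.+1%:R @[n --> \oo] --> c.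
Proof.
move=> c_ge0.
(* The lower bound comes from cn - 1 = c (n + 1) - (c + 1). *)
apply: (squeeze_cvgr (f := fun n => c - (c + 1) * n.+1%:R^-1) (h := fun=> c)).
- apply: nearW => n.
  have n_gt0 : 0 < n.+1%:R :> R by rewrite ltr0n.
  have /truncn_itv/andP[le_m lt_m] : 0 <= c * n%:R by rewrite mulr_ge0.
  rewrite ler_pdivrMr // ler_pdivlMr // mulrBl divfK ?gt_eqF //.
  move: lt_m le_m; rewrite -!natr1; lra.
- rewrite -[X in _ --> X]subr0 -(mulr0 (c + 1)); apply: cvgB; first exact: cvg_cst.
  apply: cvgM; [exact: cvg_cst|exact: cvg_harmonic].
- exact: cvg_cst.
Qed.

(** Bounded moments divided by n + 1 vanish, so in the limit the moment identities read Q0 (1 - c) =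
    1 and Q1 (1 - c) = c Q0. *)
Lemma cvg_fall_moment1 (R : realType) (c : R) : 0 <= c -> c < 1 ->
  fall_moment n.+1 (Num.truncn (c * n%:R)) 1 @[n --> \oo] --> c / (1 - c) ^+ 2.
Proof.
move=> c_ge0 c_lt1; pose m n := Num.truncn (c * n%:R).
have c_neq1 : 1 - c != 0 by rewrite subr_eq0 gt_eqF.
pose x n : R := (m n)%:R / n.+1%:R; pose Q p n : R := fall_moment n.+1 (m n) p.
have le_m n : (m n)%:R <= c * n.+1%:R.
  have le_cn : (m n)%:R <= c * n%:R by rewrite truncn_le mulr_ge0.
  by apply: le_trans le_cn _; rewrite ler_wpM2l // ler_nat.
have x_neq1 n : 1 - x n != 0.
  by rewrite subr_eq0 gt_eqF // (le_lt_trans _ c_lt1) // ler_pdivrMr ?ltr0n.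
have x_c : x n @[n --> \oo] --> c by exact: cvg_truncn_ratio.
have x1_c : (1 - x n)^-1 @[n --> \oo] --> (1 - c)^-1.
  by apply: cvgV => //; apply: cvgB => //; exact: cvg_cst.
have Qe p : (p <= 2)%N -> Q p n / n.+1%:R @[n --> \oo] --> (0 : R).
  move=> le_p2; apply: (cvg_bounded_div _ _ (3 / (1 - c) ^+ 3)) => n.
  by rewrite fall_moment_ge0 fall_moment_bounded.
have Q0_c : Q 0%N n @[n --> \oo] --> (1 - 0) * (1 - c)^-1.
  rewrite (_ : (fun n => Q 0%N n) = fun n => (1 - Q 1%N n / n.+1%:R) * (1 - x n)^-1).
    by apply: cvgM => //; apply: cvgB; [exact: cvg_cst|exact: Qe].
  by apply/funext => n; rewrite /Q -fall_moment0 // mulfK //; exact: x_neq1.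
have -> : c / (1 - c) ^+ 2 = (c * ((1 - 0) * (1 - c)^-1) - (0 + 0)) * (1 - c)^-1.
  by field.
rewrite (_ : (fun n => _) = fun n => (x n * Q 0%N n -
    (Q 2%N n / n.+1%:R + Q 1%N n / n.+1%:R)) * (1 - x n)^-1).
  by apply: cvgM => //; apply: cvgB; [exact: cvgM|apply: cvgD; exact: Qe].
by apply/funext => n; rewrite /Q -mulrDl -fall_moment1 // mulfK //; exact: x_neq1.
Qed.

Lemma cvg_cov_k (R : realType) (i j : nat) (c : R) :
  (0 < i)%N -> (i <= j)%N -> 0 < c -> c < 1 ->
  cov_k R (Num.truncn (c * n%:R)) n i j / (i%:R * c / (1 - c) ^+ 3)
    @[n --> \oo] --> (1 : R).
Proof.
move=> i_gt0 le_ij c_gt0 c_lt1; pose m n := Num.truncn (c * n%:R).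
have c1_gt0 : 0 < 1 - c by rewrite subr_gt0.
have c1_neq0 := lt0r_neq0 c1_gt0.
have [i_neq0 c_neq0] : i%:R != 0 :> R /\ c != 0 by rewrite pnatr_eq0 -lt0n !gt_eqF.
have covE : \forall n \near \oo,
    i%:R * fall_moment n.+1 (m n) 1 * (1 - (m n)%:R / n.+1%:R)^-1
    * (1 - j%:R * n.+1%:R^-1 * (1 - (m n)%:R / n.+1%:R)^-1)
    * (i%:R * c / (1 - c) ^+ 3)^-1
    = cov_k R (m n) n i j / (i%:R * c / (1 - c) ^+ 3).
  near=> n; rewrite cov_kE // -(ler_nat R) natrD.
  (* For such n, j + m <= j + cn <= n, as [cov_kE] requires. *)
  have : j%:R / (1 - c) <= n%:R by near: n; exact: nbhs_infty_ger.
  rewrite ler_pdivrMr //; have : (m n)%:R <= c * n%:R.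
    by rewrite truncn_le mulr_ge0 // ltW.
  lra.
have lim1 : i%:R * (c / (1 - c) ^+ 2) * (1 - c)^-1
    * (1 - j%:R * 0 * (1 - c)^-1) * (i%:R * c / (1 - c) ^+ 3)^-1 = 1.
  by field; rewrite c1_neq0 c_neq0.
rewrite -[X in _ --> X]lim1; apply: cvg_trans (near_eq_cvg covE) _.
have x1_c : (1 - (m n)%:R / n.+1%:R)^-1 @[n --> \oo] --> (1 - c)^-1.
  apply: cvgV => //; apply: cvgB; first exact: cvg_cst.
  by apply: cvg_truncn_ratio; exact: ltW.
apply: cvgM; last exact: cvg_cst; apply: cvgM.
  by apply: cvgM => //; apply: cvgM; [exact: cvg_cst|apply: cvg_fall_moment1 => //; exact: ltW].
apply: cvgB; first exact: cvg_cst.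
by apply: cvgM => //; apply: cvgM; [exact: cvg_cst|exact: cvg_harmonic].
Unshelve. all: by end_near.
Qed.

Theorem proposition3p9 (R : realType) (i j : nat) (c : R)
    (hi : (1 <= i)%N) (hij : (i < j)%N) (hc0 : 0 < c) (hc1 : c < 1) :
  (var_k R (Num.truncn (c * n%:R)) n i / (i%:R * c / (1 - c) ^+ 3)
     @[n --> integral_multiples c] --> (1 : R)) /\
  (cov_k R (Num.truncn (c * n%:R)) n i j / (i%:R * c / (1 - c) ^+ 3)
     @[n --> integral_multiples c] --> (1 : R)).
Proof.
(* Truncation makes the limits valid along all n, so they pass to the n for which cn is an
   integer. *)
have restrict (u : nat -> R) (l : R) : u n @[n --> \oo] --> l ->
    u n @[n --> integral_multiples c] --> l.
  by move=> u_l; apply: cvg_trans u_l; apply: cvg_app; apply: cvg_within.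
split; apply: restrict; last exact: (cvg_cov_k _ _ _ _ hi (ltnW hij)).
(* The variance is the covariance at [j = i] by conversion, a square being a product. *)
exact: (cvg_cov_k _ i i _ hi (leqnn i)).
Qed.
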